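(* Let $0<q<n$ be integers with $\gcd(n,q)=1$, and let $\mathbb{C}_{n,q}\subset GL(2,\mathbb{C})$ be the cyclic group of order $n$ generated by $\begin{pmatrix}\zeta_n&0\\0&\zeta_n^q\end{pmatrix}$, where $\zeta_n=e^{2\pi i/n}$. Let $\rho_{\mathrm{Nat}}$ be its natural representation (the inclusion in $GL(2,\mathbb{C})$). The McKay quiver $Q_{\rho_{\mathrm{Nat}}}(\mathbb{C}_{n,q})$ has $n$ vertices $\beta_0,\dots,\beta_{n-1}$, and from each vertex $\beta_i$ there go out exactly two arrows, one to $\beta_{i+1}$ and one to $\beta_{i+q}$, with indices taken modulo $n$ (so that, when $q=1$, there are two arrows from $\beta_i$ to $\beta_{i+1}$).
   Context: For a finite group $G$ with complex irreducible representations $\rho_0,\dots,\rho_r$ (up to isomorphism) and a complex representation $\rho$ of $G$, write $\rho\otimes\rho_i\cong\bigoplus_j a_{ij}\rho_j$. The McKay quiver $Q_\rho(G)$ has one vertex for each $\rho_i$ and $a_{ij}$ arrows from the vertex $\rho_i$ to the vertex $\rho_j$. The irreducible representations of $\mathbb{C}_{n,q}$ are the one-dimensional representations $\beta_j$, $0\le j<n$, sending the generator $\begin{pmatrix}\zeta_n&0\\0&\zeta_n^q\end{pmatrix}$ to $\zeta_n^j$; thus $\rho_{\mathrm{Nat}}=\beta_1\oplus\beta_q$. *)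

(* Defs.v *)
From HB Require Import structures.
From mathcomp Require Import all_boot all_order all_algebra all_fingroup.
From mathcomp Require Import pgroup mxrepresentation character complex.
From mathcomp Require Import boolp reals trigo.

Set Implicit Arguments.
Unset Strict Implicit.
Unset Printing Implicit Defensive.

Import GRing.Theory Num.Theory.
Local Open Scope ring_scope.
Local Open Scope complex_scope.

(* Loops and parallel arrows are allowed. *)
Record quiver := Quiver {
  vertex : finType;
  arrow : finType;
  source : arrow -> vertex;
  target : arrow -> vertex }.

Section McKay.
Variables (R : realType) (gT : finGroupType) (G : {group gT}).

(* irrType C G is by definition a complete, irredundant list of simple         *)
(* submodules of the regular representation.  By Maschke these are the         *)
(* irreducible complex representations of G up to isomorphism; irr_repr i is   *)
(* the representation with index i.                                            *)
Definition complex_irr : irrType R[i] G := DecSocleType (regular_repr R[i] G).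

(* Every representation is isomorphic to (+)_j m_j rho_j. *)
Lemma irr_decomposition n (rG : mx_representation R[i] G n) :
  exists m : complex_irr -> nat,
    mx_rsim rG
      (\big[dadd_grepr/grepr0]_j
          muln_grepr (Representation (irr_repr j)) (m j)).
Proof.
pose sG := DecSocleType rG; pose iG := complex_irr.
pose sirr (W : sG) := irr_comp iG (socle_repr W).
pose soc i := [pick W | sirr W == i].
exists (fun i => oapp (fun W => socle_mult W) O (soc i)).
pose W i := oapp val 0 (soc i); pose S := (\sum_i W i)%MS.
have C'G : ([pchar R[i]]^'.-group G)%g.
  by apply/pgroupP=> p _ _; rewrite inE /= pchar_num.
have [defS dxS]: (S :=: 1%:M)%MS /\ mxdirect S.
  rewrite /S mxdirectE /= !(bigID soc xpredT) /=.
  rewrite addsmxC big1 => [|i]; last by rewrite /W; case (soc i).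
  rewrite adds0mx_id addnC (@big1 nat) ?add0n => [|i]; last first.
    by rewrite /W; case: (soc i); rewrite ?mxrank0.
  have <-: Socle sG = 1%:M := reducible_Socle1 sG (mx_Maschke_pchar rG C'G).
  have [W0 _ | noW] := pickP sG; last first.
    suff no_i: (soc : pred iG) =1 xpred0 by rewrite /Socle !big_pred0 ?mxrank0.
    by move=> i; rewrite /soc; case: pickP => // W0; have:= noW W0.
  have irrK Wi: soc (sirr Wi) = Some Wi.
    rewrite /soc; case: pickP => [W' | /(_ Wi)] /= /eqP // eqWi.
    apply/eqP/socle_rsimP.
    apply: mx_rsim_trans
      (rsim_irr_comp_pchar iG C'G (socle_irr _)) (mx_rsim_sym _).
    by rewrite [irr_comp _ _]eqWi; apply: rsim_irr_comp_pchar (socle_irr _).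
  have bij_irr: {on [pred i | soc i], bijective sirr}.
    exists (odflt W0 \o soc) => [Wi _ | i]; first by rewrite /= irrK.
    by rewrite inE /soc /=; case: pickP => //= Wi; move/eqP.
  rewrite !(reindex sirr) {bij_irr}//=.
  have all_soc Wi: soc (sirr Wi) by rewrite irrK.
  rewrite (eq_bigr val) => [|Wi _]; last by rewrite /W irrK.
  rewrite !(eq_bigl _ _ all_soc); split=> //.
  rewrite (eq_bigr (mxrank \o val)) => [|Wi _]; last by rewrite /W irrK.
  by rewrite -mxdirectE /= Socle_direct.
pose modW i : mxmodule rG (W i) :=
  if soc i is Some Wi as oWi return mxmodule rG (oapp val 0 oWi) then
    component_mx_module rG (socle_base Wi)
  else mxmodule0 rG n.
apply: mx_rsim_trans (mx_rsim_sym (rsim_submod1 (mxmodule1 rG) _)) _ => //.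
apply: mx_rsim_dsum (modW) _ defS dxS _ => i.
rewrite /W /modW /soc; case: pickP => [Wi|_] /=; last first.
  rewrite /muln_grepr big_ord0.
  by exists 0 => [||x _]; rewrite /row_free ?mxrank0 ?mulmx0 ?mul0mx.
move/eqP=> <-; apply: mx_rsim_socle.
exact: rsim_irr_comp_pchar (socle_irr Wi).
Qed.

Definition irr_mult n (rG : mx_representation R[i] G n) : complex_irr -> nat :=
  projT1 (cid (irr_decomposition rG)).

Lemma irr_multP n (rG : mx_representation R[i] G n) :
  mx_rsim rG
    (\big[dadd_grepr/grepr0]_j
        muln_grepr (Representation (irr_repr j)) (irr_mult rG j)).
Proof. exact: (projT2 (cid (irr_decomposition rG))). Qed.

Variables (d : nat) (rho : mx_representation R[i] G d).

(* prod_repr is the tensor product of representations. *)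
Definition mckay_coef (i j : complex_irr) : nat :=
  irr_mult (prod_repr rho (irr_repr i)) j.

Definition mckay_quiver : quiver :=
  @Quiver complex_irr
    {ij : complex_irr * complex_irr & 'I_(mckay_coef ij.1 ij.2)}
    (fun e => (tag e).1) (fun e => (tag e).2).

End McKay.

Section CyclicGroup.
Variables (R : realType) (n q : nat).

(* exp(2 i pi / n), in real and imaginary parts. *)
Definition zeta : R[i] := cos (2 * pi / n%:R) +i* sin (2 * pi / n%:R).

Definition cyc_gen : 'M[R[i]]_2 :=
  \matrix_(i, j) if i != j then 0 else if i == 0 then zeta else zeta ^+ q.

(* The subgroup of GL(2, C) generated by cyc_gen: all its integral powers. *)
Definition in_cyc (A : 'M[R[i]]_2) : bool := `[< exists k : int, A = cyc_gen ^ k >].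

Definition cyc : Type := {A : 'M[R[i]]_2 | in_cyc A}.

HB.instance Definition _ := [isSub of cyc for @sval _ _].
HB.instance Definition _ := [Choice of cyc by <:].

Lemma in_cycP A : reflect (exists k : int, A = cyc_gen ^ k) (in_cyc A).
Proof. exact: asboolP. Qed.

Lemma zetaX k :
  zeta ^+ k = cos (2 * pi / n%:R *+ k) +i* sin (2 * pi / n%:R *+ k).
Proof.
rewrite /zeta; set t := (_ / _); elim: k => [|k IHk].
  by rewrite expr0 mulr0n cos0 sin0.
rewrite exprSr IHk mulrSr cosD sinD; apply/eqP; rewrite eq_complex /=.
by rewrite eqxx addrC eqxx.
Qed.

(* n.-1.+1 is n for n > 0; for n = 0 the group is trivial. *)
Lemma zetaXn : zeta ^+ n.-1.+1 = 1.
Proof.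
rewrite zetaX; case: n => [|m] /=; first by rewrite invr0 mulr0 cos0 sin0.
by rewrite -mulr_natr divfK ?pnatr_eq0 // mulr_natl cos2pi sin2pi.
Qed.

Lemma cyc_genX k : cyc_gen ^+ k =
  \matrix_(i, j) if i != j then 0
                 else if i == 0 then zeta ^+ k else zeta ^+ q ^+ k.
Proof.
elim: k => [|k IHk]; apply/matrixP=> i j.
  by rewrite expr0 !mxE !expr0 if_same; case: eqP.
rewrite exprSr IHk !mxE (bigD1 i) //= big1 => [|l /negPf ne_li].
  rewrite !mxE eqxx /= addr0; case: (i =P j) => _ /=; last by rewrite mulr0.
  by case: ifP; rewrite exprSr.
by rewrite !mxE eq_sym ne_li mul0r.
Qed.

Lemma cyc_genXn : cyc_gen ^+ n.-1.+1 = 1.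
Proof.
rewrite cyc_genX exprAC zetaXn expr1n; apply/matrixP=> i j.
by rewrite !mxE if_same; case: eqP.
Qed.

Lemma cyc_gen_unit : cyc_gen \is a GRing.unit.
Proof.
apply/unitrP; exists (cyc_gen ^+ n.-1).
by rewrite -exprS -exprSr cyc_genXn.
Qed.

Lemma in_cyc1 : in_cyc 1.
Proof. by apply/in_cycP; exists 0; rewrite expr0z. Qed.

Lemma in_cycM A B : in_cyc A -> in_cyc B -> in_cyc (A *m B).
Proof.
move=> /in_cycP[k ->] /in_cycP[l ->]; apply/in_cycP; exists (k + l).
by rewrite exprzDr ?cyc_gen_unit.
Qed.

Lemma in_cycV A : in_cyc A -> in_cyc (invmx A).
Proof.
by move=> /in_cycP[k ->]; apply/in_cycP; exists (- k); rewrite -invr_expz.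
Qed.

Lemma in_cyc_gen : in_cyc cyc_gen.
Proof. by apply/in_cycP; exists 1; rewrite expr1z. Qed.

Lemma in_cyc_ord A : in_cyc A -> exists k : 'I_n.-1.+1, A == cyc_gen ^+ k.
Proof.
move=> /in_cycP[k ->].
have expm (l : nat) : exists k : 'I_n.-1.+1, cyc_gen ^+ l == cyc_gen ^+ k.
  exists (Ordinal (ltn_pmod l (ltn0Sn n.-1))); rewrite /= {1}(divn_eq l n.-1.+1).
  by rewrite exprD mulnC exprM cyc_genXn expr1n mul1r.
case: k => [l|l]; first exact: expm.
have [k /eqP Ek] := expm (l.+1 * n.-1)%N.
exists k; rewrite -Ek NegzE -exprnN.
rewrite -(inj_eq (mulIr (unitrX l.+1 cyc_gen_unit))) mulVr ?unitrX ?cyc_gen_unit //.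
by rewrite -exprD -mulnSr mulnC exprM cyc_genXn expr1n.
Qed.

Definition cyc_log (A : cyc) : 'I_n.-1.+1 := xchoose (in_cyc_ord (valP A)).
Definition cyc_exp (k : 'I_n.-1.+1) : cyc :=
  insubd (Sub 1 in_cyc1 : cyc) (cyc_gen ^+ k).

Lemma cyc_logK : cancel cyc_log cyc_exp.
Proof.
move=> A; rewrite /cyc_exp -(eqP (xchooseP (in_cyc_ord (valP A)))).
exact: valKd.
Qed.

HB.instance Definition _ := CanIsCountable cyc_logK.
HB.instance Definition _ : isFinite cyc := CanIsFinite cyc_logK.

Definition cyc_mul (A B : cyc) : cyc := Sub (val A *m val B) (in_cycM (valP A) (valP B)).
Definition cyc_one : cyc := Sub 1 in_cyc1.
Definition cyc_inv (A : cyc) : cyc := Sub (invmx (val A)) (in_cycV (valP A)).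

Fact cyc_mulA : associative cyc_mul.
Proof. by move=> A B C; apply: val_inj; rewrite /= mulmxA. Qed.

Fact cyc_mul1 : left_id cyc_one cyc_mul.
Proof. by move=> A; apply: val_inj; rewrite /= mul1mx. Qed.

Fact cyc_mulV : left_inverse cyc_one cyc_inv cyc_mul.
Proof.
move=> A; apply: val_inj; rewrite /= mulVmx //.
by have /in_cycP[k ->] := valP A; apply: unitrXz; apply: cyc_gen_unit.
Qed.

HB.instance Definition _ := Finite_isGroup.Build cyc cyc_mulA cyc_mul1 cyc_mulV.

Definition cyc_generator : cyc := Sub cyc_gen in_cyc_gen.

Lemma nat_mx_repr : mx_repr [set: cyc] (fun A : cyc => val A).
Proof. by split. Qed.

Definition nat_repr : mx_representation R[i] [set: cyc] 2 :=
  MxRepresentation nat_mx_repr.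

End CyclicGroup.

(* Main.v *)
(** The generator g has order n, and a cyclic group of order n has exactly n
    irreducible representations, all linear and separated by their value on g,
    which is a power of zeta.  The trace of rho_Nat (x) beta_i at g ^ k is
    zeta ^ ((i + 1) * k) + zeta ^ ((i + q) * k).  A family of coefficients on
    'Z_n is determined by its discrete Fourier transform, so these traces force
    the multiplicity of beta_j to be [j = i + 1] + [j = i + q]. *)
Require Import Defs.
From mathcomp Require Import all_boot all_order all_algebra all_fingroup.
From mathcomp Require Import mxrepresentation character complex reals.
From mathcomp Require Import pgroup cyclic trigo lra.

Set Implicit Arguments.
Unset Strict Implicit.
Unset Printing Implicit Defensive.

Import GRing.Theory Num.Theory.
Local Open Scope ring_scope.

(** The differences [c j - d j] are the coefficients of a polynomial of size at most [n] that
    vanishes at the [n] distinct powers of [z]. *)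
Lemma fourier_inj (F : fieldType) n (z : F) (c d : 'I_n -> F) :
    n.-primitive_root z ->
    (forall k, \sum_j c j * z ^+ (j * k) = \sum_j d j * z ^+ (j * k)) ->
  c =1 d.
Proof.
move=> prim_z eq_cd.
pose p := \poly_(i < n) oapp (fun j => c j - d j) 0 (insub i).
suff p0 : p = 0.
  move=> j; apply/eqP; rewrite -subr_eq0; apply/eqP.
  by have := coef0 F j; rewrite -p0 coef_poly ltn_ord valK.
pose rs := [seq z ^+ (k : 'I_n) | k : 'I_n].
apply: (@roots_geq_poly_eq0 _ _ rs).
- apply/allP=> _ /imageP[k _ ->]; rewrite rootE horner_poly.
  under eq_bigr do rewrite valK /= mulrBl -exprM mulnC.
  by rewrite sumrB eq_cd subrr.
- rewrite map_inj_uniq ?enum_uniq // => k l /eqP.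
  by rewrite (eq_prim_root_expr prim_z) !modn_small // => /eqP/val_inj.
- by rewrite size_map -cardE card_ord size_poly.
Qed.

Section Quiver.
Variables (R : realType) (gT : finGroupType) (G : {group gT}).
Local Notation C := R[i]%C.

(** The multiplicities are only chosen through an isomorphism; taking traces turns it into linear
    equations for them. *)
Lemma mxtrace_irr_mult n (rG : mx_representation C G n) x : x \in G ->
  \tr (rG x) =
    \sum_j (irr_mult rG j)%:R * \tr (irr_repr (j : complex_irr R G) x).
Proof.
move=> Gx; rewrite (mxtrace_rsim (irr_multP rG) Gx).
have tr_dsum (I : finType) (r : I -> representation C G) :
    \tr ((\big[dadd_grepr/grepr0]_j r j) x) = \sum_j \tr (r j x).
  pose tr_is (r0 : representation C G) t := \tr (r0 x) = t.
  apply: (big_ind2 tr_is) => // [|r1 _ r2 _ <- <-]; first exact: mxtrace1.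
  exact: mxtrace_block.
rewrite tr_dsum; apply: eq_bigr => j _.
by rewrite tr_dsum sumr_const card_ord mulr_natl.
Qed.

Variables (d : nat) (rho : mx_representation C G d).

Lemma two_arrows (i j1 j2 : complex_irr R G) :
    (forall j, mckay_coef rho i j = ((j == j1) + (j == j2))%N) ->
  exists e1 e2 : arrow (mckay_quiver rho),
    [/\ e1 != e2, forall e : arrow (mckay_quiver rho),
          source e = i <-> e = e1 \/ e = e2,
        target e1 = j1 & target e2 = j2].
Proof.
move=> coefE.
have lt1 : (0 < mckay_coef rho i j1)%N by rewrite coefE eqxx.
(* The index [j1 == j2] keeps the two arrows distinct when they are parallel. *)
have lt2 : ((j1 == j2) < mckay_coef rho i j2)%N.
  by rewrite coefE eqxx eq_sym; case: eqP.
pose mk j (k : 'I_(mckay_coef rho i j)) : arrow (mckay_quiver rho) :=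
  existT (fun ij => 'I_(mckay_coef rho ij.1 ij.2)) (i, j) k.
exists (mk j1 (Ordinal lt1)), (mk j2 (Ordinal lt2)).
(* The ordinals live in types depending on the target, so they are compared as natural numbers. *)
have mkP j j' (k : 'I_(mckay_coef rho i j)) (k' : 'I_(mckay_coef rho i j')) :
    j = j' -> k = k' :> nat -> mk j k = mk j' k'.
  by move=> Ej; case: _ / Ej k' => k' /val_inj->.
split=> //.
  apply/eqP => E; have Ej : j1 = j2 := congr1 (fun e => (tag e).2) E.
  have := congr1 (fun e => nat_of_ord (tagged e)) E.
  by rewrite /= Ej eqxx.
move=> e; split=> [|[] -> //].
case: e => [[i' j] k] /= Ei; subst i'.
rewrite -/(mk j k).
have: (k < (j == j1) + (j == j2))%N by rewrite -coefE.
(* The index [k] is 0 or 1 if [j = j1 = j2], is 0 if [j] equals just one of them, and cannot exist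
   otherwise. *)
case: (j =P j1) => [Ej1|nEj1]; case: (j =P j2) => [Ej2|_].
- rewrite ltnS; case Ek: (k : nat) => [|[|//]] _.
    by left; apply: mkP.
  by right; apply: mkP; rewrite //= -Ej1 -Ej2 eqxx.
- rewrite ltnS leqn0 => /eqP Ek.
  by left; apply: mkP.
- rewrite ltnS leqn0 => /eqP Ek.
  right; apply: mkP => //=; rewrite Ek -Ej2.
  by case: eqP => // /esym/nEj1.
- by [].
Qed.

End Quiver.

Section CyclicGroup.
Variables (R : realType) (n q : nat).
Local Notation z := (zeta R n).
Local Notation g := (cyc_generator R n q).

(** For [0 < m < n], the real part of [z ^+ m] is the cosine of [2t] with [t = m * pi / n] in
    [(0, pi)]; it equals [1 - 2 sin(t)^2 < 1]. *)
Lemma zeta_prim : (0 < n)%N -> n.-primitive_root z.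
Proof.
move=> n_gt0; apply/andP; split=> //; apply/forallP=> -[k lt_k_n] /=.
rewrite unity_rootE; have [<-|ne_kn] := eqVneq k.+1 n.
  by have := zetaXn R k.+1; rewrite /= => ->; rewrite eqxx.
rewrite zetaX eqbF_neg; apply/eqP=> /(congr1 (@complex.Re R)) /=.
pose t : R := pi / n%:R *+ k.+1.
have ->: 2 * pi / n%:R *+ k.+1 = t *+ 2.
  by rewrite -mulrA mulr_natl mulrnAC.
have t_gt0: (0 < t < pi)%R.
  rewrite mulrn_wgt0 ?divr_gt0 ?pi_gt0 ?ltr0n //=.
  rewrite /t -mulrnAl ltr_pdivrMr ?ltr0n // -mulr_natr ltr_pM2l ?pi_gt0 //.
  by rewrite ltr_nat ltn_neqAle ne_kn.
rewrite cos_mulr2n cos2sin2 => /eqP.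
have := sin_gt0_pi t_gt0.
nra.
Qed.

Hypothesis n_gt0 : (0 < n)%N.

Lemma val_cyc_generatorX k : val (g ^+ k)%g = cyc_gen R n q ^+ k.
Proof.
by elim: k => // k IHk; rewrite expgS exprS -IHk.
Qed.

Lemma cyc_generatorT : [set: cyc R n q] = <[g]>%g.
Proof.
apply/esym/setP=> A; rewrite inE; apply/cycleP.
have [k /eqP Ek] := in_cyc_ord (valP A).
by exists k; apply: val_inj; rewrite val_cyc_generatorX.
Qed.

Lemma order_cyc_generator : #[g]%g = n.
Proof.
apply/eqP; rewrite eqn_dvd order_dvdn; apply/andP; split.
  apply/eqP/val_inj; rewrite val_cyc_generatorX -[in LHS](prednK n_gt0).
  exact: cyc_genXn.
(* The top left entry of [g ^ #[g] = 1] gives [z ^+ #[g] = 1]. *)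
rewrite (prim_order_dvd (zeta_prim n_gt0)).
have := val_cyc_generatorX #[g]%g; rewrite expg_order cyc_genX.
by move=> /(congr1 (fun A : 'M_2 => A 0 0)); rewrite !mxE /= => <-.
Qed.

Lemma mxtrace_nat_repr k :
  \tr (nat_repr R n q (g ^+ k)%g) = z ^+ k + z ^+ (q * k).
Proof.
rewrite [nat_repr _ _ _ _]val_cyc_generatorX cyc_genX.
by rewrite /mxtrace big_ord_recl big_ord1 !mxE /= exprM.
Qed.

Lemma cyc_splitting : group_splitting_field R[i]%C [set: cyc R n q].
Proof.
apply: (@primitive_root_splitting_abelian _ _ _ z).
  by rewrite /= cyc_generatorT -orderE order_cyc_generator; apply: zeta_prim.
by rewrite /= cyc_generatorT cycle_abelian.
Qed.

Local Notation irr := (complex_irr R [set: cyc R n q]).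

Lemma cyc_irr : #|irr| = n /\
  exists beta : 'I_n -> irr, bijective beta /\
    forall j, irr_repr (beta j) g = (z ^+ j)%:M.
Proof.
have C'G : ([pchar R[i]%C]^'.-group [set: cyc R n q])%g.
  by apply/pgroupP=> p _ _; rewrite inE /= pchar_num.
have [w prim_w [iphi [bij_iphi cardE _ iphiE]]] :=
  cycle_repr_structure_pchar irr cyc_generatorT C'G cyc_splitting.
move: iphi bij_iphi iphiE; rewrite cardE in prim_w *.
have cardG : #|[set: cyc R n q]| = n.
  by rewrite cyc_generatorT -orderE order_cyc_generator.
rewrite cardG in prim_w * => iphi bij_iphi iphiE; split=> //.
(* The structure theorem labels irreducibles by powers of some primitive root [w]; discrete
   logarithms to base [w] relabel them by powers of [z]. *)
have log j : exists i : 'I_n, z ^+ (j : 'I_n) == w ^+ i.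
  have [i ->] : {i : 'I_n | z ^+ j = w ^+ i}.
    apply: (prim_rootP prim_w).
    by rewrite exprAC (prim_expr_order (zeta_prim n_gt0)) expr1n.
  by exists i.
pose f j := xchoose (log j).
have fE j : w ^+ f j = z ^+ j by rewrite -(eqP (xchooseP (log j))).
exists (iphi \o f); split=> [|j]; last by rewrite /= iphiE fE.
apply: bij_comp => //; apply: injF_bij => j k Ejk.
have /eqP : z ^+ j = z ^+ k by rewrite -!fE Ejk.
rewrite (eq_prim_root_expr (zeta_prim n_gt0)) !modn_small //.
by move=> /eqP/val_inj.
Qed.

End CyclicGroup.

(* Since 1 < n, 'Z_n is the ring of integers modulo n, with elements 0, ..., n-1. *)
Theorem mainTheorem2 (R : realType) (n q : nat)
    (q_gt0 : (0 < q)%N) (q_lt_n : (q < n)%N) (co_nq : coprime n q) :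
  let Q := mckay_quiver (nat_repr R n q) in
  #|vertex Q| = n /\
  exists beta : 'Z_n -> vertex Q,
    [/\ bijective beta,
        forall j : 'Z_n, irr_degree (beta j) = 1%N /\
          irr_repr (beta j) (cyc_generator R n q) = (zeta R n ^+ j)%:M
      & forall i : 'Z_n, exists e1 e2 : arrow Q,
          [/\ e1 != e2,
              forall e : arrow Q, source e = beta i <-> e = e1 \/ e = e2,
              target e1 = beta (i + 1)
            & target e2 = beta (i + q%:R)]].
Proof.
have n_gt1 : (1 < n)%N by apply: leq_ltn_trans q_lt_n.
have n_gt0 : (0 < n)%N by apply: ltnW.
have ZnE := Zp_cast n_gt1.
(* ['Z_n] unfolds to ['I_(Zp_trunc n).+2], so the order is put in that form for [fourier_inj]. *)
have prim_z : (Zp_trunc n).+2.-primitive_root (zeta R n).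
  by rewrite ZnE; apply: zeta_prim.
have [card_irr irrP] := cyc_irr R q n_gt0; split; first exact: card_irr.
have {irrP} [beta [bij_beta betaE]] :
  exists beta : 'Z_n -> complex_irr R [set: cyc R n q], bijective beta /\
    forall j, irr_repr (beta j) (cyc_generator R n q) = (zeta R n ^+ j)%:M.
  by rewrite ZnE.
have degE j : irr_degree (beta j) = 1%N.
  apply: irr_degree_abelian; first exact: cyc_splitting.
  by rewrite /= cyc_generatorT // cycle_abelian.
have trE j k : \tr (irr_repr (beta j) (cyc_generator R n q ^+ k)%g) =
    zeta R n ^+ (j * k).
  (* The matrix size depends on [beta j], so the representation is generalized before its degree
     becomes 1. *)
  move: (irr_repr (beta j)) (betaE j); rewrite degE => rG rG_gE.
  rewrite repr_mxX ?inE // rG_gE exprM -rmorphXn.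
  exact: mxtrace_scalar.
exists beta; split=> // i; apply: two_arrows => W.
have [beta' _ betaK] := bij_beta.
rewrite -[W]betaK !(bij_eq bij_beta); move: (beta' W) => {W} j.
(* Naturals embed in [R[i]] (characteristic 0), where the Fourier argument applies. *)
apply/eqP; rewrite -(eqr_nat R[i]%C); apply/eqP; move: j.
apply: (fourier_inj prim_z) => k.
have := mxtrace_irr_mult (prod_repr (nat_repr R n q) (irr_repr (beta i)))
  (in_setT (cyc_generator R n q ^+ k)%g).
rewrite (reindex beta) /=; last exact: onW_bij.
under eq_bigr do rewrite trE.
move=> <-; rewrite mxtrace_prod mxtrace_nat_repr trE.
(* Addition in ['Z_n] reduces modulo [n], which powers of [zeta] do not see. *)
have zD (j l : 'Z_n) :
    zeta R n ^+ ((j + l)%R * k) = zeta R n ^+ (j * k) * zeta R n ^+ (l * k).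
  rewrite -exprD -mulnDl !exprM; congr (_ ^+ _).
  by rewrite (prim_expr_mod prim_z).
have delta (l : 'Z_n) :
    \sum_(j : 'Z_n) (j == l)%:R * zeta R n ^+ (j * k) = zeta R n ^+ (l * k).
  rewrite (bigD1 l) //= eqxx mul1r big1 ?addr0 // => j /negPf->.
  by rewrite mul0r.
under eq_bigr do rewrite natrD mulrDl.
rewrite big_split mulrDl; congr (_ + _); rewrite delta zD mulrC.
  by rewrite mul1n.
(* [q%:R] has value [q %% n], which is [q] since [q < n]. *)
by rewrite val_Zp_nat // modn_small.
Qed.
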